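(* Let $P\in\mathcal{B}(\mathcal{H})$ be an idempotent, written as $$P=\begin{pmatrix} I & P_1\\ 0&0\end{pmatrix}:R(P)\oplus R(P)^{\perp},\qquad P_1\in\mathcal{B}(R(P)^{\perp},R(P)),$$ and let $J\in\mathcal{B}(\mathcal{H})$ be a symmetry. If $JPJ=I-P^{*}$, then $\dim R(P)=\dim R(P)^{\perp}$ and $$J=\begin{pmatrix} 0&\sqrt{-1}\,U^{*}\\ -\sqrt{-1}\,U&0\end{pmatrix}:R(P)\oplus R(P)^{\perp},$$ where $U=J_1V_1^{*}\oplus U_2$ with respect to the space decompositions $R(P)=\overline{R(P_1)}\oplus R(P_1)^{\perp}$ (domain) and $R(P)^{\perp}=N(P_1)^{\perp}\oplus N(P_1)$ (codomain). Here $V_1$ is the unique unitary operator from $\overline{R(P_1^{*})}$ onto $\overline{R(P_1)}$ with $P_1=V_1(P_1^{*}P_1)^{\frac12}$, $J_1\in\mathcal{B}(N(P_1)^{\perp})$ is a symmetry with $(J_1\oplus 0)P_1^{*}P_1=P_1^{*}P_1(J_1\oplus 0)$, and $U_2$ is a unitary operator from $R(P_1)^{\perp}$ onto $N(P_1)$.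
   Context: $\mathcal{H}$ is a separable complex Hilbert space; $\mathcal{B}(\mathcal{H},\mathcal{K})$ is the set of bounded linear operators from $\mathcal{H}$ to $\mathcal{K}$, and $\mathcal{B}(\mathcal{H})=\mathcal{B}(\mathcal{H},\mathcal{H})$. An idempotent is $P\in\mathcal{B}(\mathcal{H})$ with $P^2=P$ (not necessarily self-adjoint); its range $R(P)$ is closed, so $P$ always has the displayed $2\times2$ operator matrix form. A symmetry is an operator $J$ with $J=J^*=J^{-1}$. $N(T)$, $R(T)$, $\overline{R(T)}$ denote the null space, range and closure of the range of $T$. $R(P_1)^{\perp}$ is the orthogonal complement of $R(P_1)$ within $R(P)$, and $N(P_1)^{\perp}=\overline{R(P_1^* )}$ is the orthogonal complement of $N(P_1)$ within $R(P)^\perp$; $J_1\oplus 0$ acts on $N(P_1)^{\perp}\oplus N(P_1)=R(P)^{\perp}$. $\dim$ is the Hilbert space dimension. *)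

(* Defs.v *)
From HB Require Import structures.
From mathcomp Require Import all_boot all_order all_algebra.
From mathcomp Require Import sesquilinear complex.
From mathcomp Require Import mathcomp_extra boolp classical_sets functions.
From mathcomp Require Import cardinality reals topology normedtype ring.

Set Implicit Arguments.
Unset Strict Implicit.
Unset Printing Implicit Defensive.

Import Order.TTheory GRing.Theory Num.Theory.
Import numFieldNormedType.Exports.

Local Open Scope classical_set_scope.
Local Open Scope card_scope.
Local Open Scope ring_scope.

(* The inner product is linear in its first argument and conjugate-linear in
   its second one. *)
HB.mixin Record CompleteNormedModule_isHilbert (R : realType) H
    & CompleteNormedModule R[i] H := {
  inner : {dot H for @Num.conj R[i]} ;
  sqr_norm_inner : forall x : H, `|x| ^+ 2 = inner x x
}.

#[short(type="hilbertType")]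
HB.structure Definition Hilbert (R : realType) :=
  {H of CompleteNormedModule R[i] H & CompleteNormedModule_isHilbert R H}.

Notation "''[' x , y ]" := (inner x%R y%R) : ring_scope.

Section HilbertBasics.
Context {R : realType} {H : hilbertType R}.
Implicit Types x y z : H.

Lemma innerC x y : '[x, y] = ('[y, x])^*.
Proof. by rewrite hermC expr0 mul1r. Qed.

Lemma innerDl x y z : '[x + y, z] = '[x, z] + '[y, z].
Proof. exact: linearDl. Qed.

Lemma innerBl x y z : '[x - y, z] = '[x, z] - '[y, z].
Proof. exact: linearBl. Qed.

Lemma innerDr x y z : '[x, y + z] = '[x, y] + '[x, z].
Proof. exact: linearDr. Qed.

Lemma innerBr x y z : '[x, y - z] = '[x, y] - '[x, z].
Proof. exact: linearBr. Qed.

Lemma innerZl a x y : '[a *: x, y] = a * '[x, y].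
Proof. exact: linearZl_LR. Qed.

Lemma innerZr a x y : '[x, a *: y] = a^* * '[x, y].
Proof. exact: linearZr_LR. Qed.

Lemma inner0l x : '[0, x] = 0.
Proof. exact: linear0l. Qed.

Lemma CauchySchwarz_inner x y : `|'[x, y]| <= `|x| * `|y|.
Proof.
have [->|y0] := eqVneq y 0; first by rewrite linear0r normr0 mulr_ge0.
have c0 : 0 < '[y, y] by rewrite -sqr_norm_inner exprn_gt0 // normr_gt0.
rewrite -(@ler_pXn2r _ 2) ?nnegrE ?mulr_ge0 // exprMn !sqr_norm_inner.
have : 0 <= `| '[y, y] *: x - '[x, y] *: y | ^+ 2 by rewrite exprn_ge0.
rewrite sqr_norm_inner innerBl !innerBr !innerZl !innerZr -(innerC y y).
rewrite -(innerC y x) normCK -(innerC y x).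
rewrite (_ : _ - _ = '[y, y] * ('[x, x] * '[y, y] - '[x, y] * '[y, x])).
  by rewrite pmulr_rge0 // subr_ge0.
ring.
Qed.

End HilbertBasics.

Definition separable_space (T : topologicalType) :=
  exists2 D : set T, countable D & dense D.

Record bounded_op (R : realType) (H K : hilbertType R) := BoundedOp {
  bop_fun :> {linear H -> K} ;
  bop_bounded : exists C : R[i], forall x, `|bop_fun x| <= C * `|x|
}.

Notation "''B' ( H , K )" := (bounded_op H K)
  (at level 8, format "''B' ( H ,  K )") : type_scope.
Notation "''B' ( H )" := (bounded_op H H)
  (at level 8, format "''B' ( H )") : type_scope.

Section BoundedOperators.
Context {R : realType} {H K : hilbertType R}.

HB.instance Definition _ := gen_eqMixin 'B(H, K).
HB.instance Definition _ := gen_choiceMixin 'B(H, K).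

Lemma bop0_bounded :
  exists C : R[i], forall x : H, `|(\0 : {linear H -> K}) x| <= C * `|x|.
Proof. by exists 0 => x; rewrite normr0 mul0r. Qed.

Definition bop0 : 'B(H, K) := BoundedOp bop0_bounded.

Lemma bop_pos_bound (T : 'B(H, K)) :
  exists2 C : R[i], 0 < C & forall x, `|T x| <= C * `|x|.
Proof.
have [C hC] := bop_bounded T; exists (`|C| + 1) => [|x].
  by rewrite ltr_wpDl.
have h : 0 <= C * `|x| by apply: le_trans (hC x).
rewrite mulrDl mul1r ler_wpDr // (le_trans (hC x)) //.
by rewrite -(ger0_norm h) normrM normr_id.
Qed.

End BoundedOperators.

Section AdjointRoot.
Context {R : realType}.

(* The adjoint exists by the Riesz representation theorem, so the default
   value of [xget] is never used. *)
Definition adj (H K : hilbertType R) (T : 'B(H, K)) : 'B(K, H) :=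
  xget bop0 [set S : 'B(K, H) | forall x y, '[T x, y] = '[x, S y]].

Definition positive_op (H : hilbertType R) (A : 'B(H)) :=
  forall x, 0 <= '[A x, x].

(* The square root of a bounded positive operator exists and is unique, so the
   default value of [xget] is not used at such operators. *)
Definition sqrt_op (H : hilbertType R) (A : H -> H) : 'B(H) :=
  xget bop0 [set S : 'B(H) | positive_op S /\ S \o S =1 A].

Definition symmetry (H : hilbertType R) (J : 'B(H)) :=
  J =1 adj J /\ cancel J J.

Definition unitary (H K : hilbertType R) (V : 'B(H, K)) :=
  cancel V (adj V) /\ cancel (adj V) V.

End AdjointRoot.

Section ClosedSubspaces.
Context {R : realType}.

Record csubspace (H : hilbertType R) := CSubspace {
  sset : set H ;
  sset0 : sset 0 ;
  sset_linear : forall (a : R[i]) x y, sset x -> sset y -> sset (a *: x + y) ;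
  sset_closed : closed sset
}.

Context {H : hilbertType R}.
Implicit Types M N : csubspace H.

Definition smem M : {pred H} := fun x => `[< sset M x >].

Lemma smem_submod M : submod_closed (smem M).
Proof.
split; first by apply/asboolP; exact: sset0.
by move=> a x y /asboolP Mx /asboolP My; apply/asboolP; exact: sset_linear.
Qed.

HB.instance Definition _ M := GRing.isSubmodClosed.Build R[i] H (smem M)
  (smem_submod M).

(* A closed subspace as a Hilbert space in its own right. *)
Record sub_of M := SubOf { sub_val : H; _ : sub_val \in smem M }.

HB.instance Definition _ M := [isSub for @sub_val M].
HB.instance Definition _ M := [Choice of sub_of M by <:].
HB.instance Definition _ M := [SubChoice_isSubLmodule of sub_of M by <:].

End ClosedSubspaces.

Section SubspaceHilbert.
Context {R : realType} {H : hilbertType R} (M : csubspace H).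
Local Notation T := (sub_of M).
Implicit Types x y : T.

Let snorm x : R[i] := `|val x|.

Lemma snormD x y : snorm (x + y) <= snorm x + snorm y.
Proof. by rewrite /snorm raddfD ler_normD. Qed.

Lemma snormZ (l : R[i]) x : snorm (l *: x) = `|l| * snorm x.
Proof. by rewrite /snorm linearZ normrZ. Qed.

Lemma snorm_eq0 x : snorm x = 0 -> x = 0.
Proof. by move=> /normr0_eq0 x0; apply: val_inj; rewrite x0 raddf0. Qed.

HB.instance Definition _ := Lmodule_isNormed.Build R[i] T snormD snormZ snorm_eq0.

Lemma snormE x : `|x| = `|val x|.
Proof. by []. Qed.

Lemma sub_complete (F : set_system T) : ProperFilter F -> cauchy F -> cvg F.
Proof.
move=> FF /cauchy_ballP cF.
have /cauchy_cvg/cvg_ex[l vl] : cauchy (val @ F).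
  apply/cauchy_ballP => e e0; have [[A B] /= [FA FB] AB] := cF e e0.
  exists (val @` A, val @` B) => /=.
    by split; rewrite /nbhs /=; [apply: filterS FA|apply: filterS FB] => z Az;
      exists z.
  move=> [_ _] /= [[a Aa <-] [b Bb <-]].
  by have := AB (a, b) (conj Aa Bb); rewrite /= -!ball_normE /ball_ /= snormE raddfB.
have Ml : sset M l.
  apply: (sset_closed (c := M)) => U /vl FU.
  have [x /= Ux] := filter_ex (FU : F (val @^-1` U)); exists (val x); split => //.
  by case: x {Ux} => x /= /asboolP.
apply/cvg_ex; exists (SubOf (asboolT Ml)).
apply/cvgrPdist_lt => e e0.
have : \forall x \near F, `|l - val x| < e by move/cvgrPdist_lt : vl; apply.
by move=> ?; near=> x; rewrite snormE raddfB /=; near: x.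
Unshelve. all: by end_near.
Qed.

HB.instance Definition _ := Uniform_isComplete.Build T sub_complete.

Definition sub_inner x y : R[i] := '[val x, val y].

Lemma sub_inner_bilinear :
  bilinear_for (GRing.Scale.Law.clone _ _ *%R _)
    (GRing.Scale.Law.clone _ _ (@Num.conj R[i] \; *%R) _) sub_inner.
Proof.
have valP a x y : val (a *: x + y) = a *: val x + val y by rewrite linearP.
split=> [y a x x'|x a y y']; rewrite /sub_inner valP.
  by rewrite innerDl innerZl.
by rewrite innerDr innerZr.
Qed.

HB.instance Definition _ := bilinear_isBilinear.Build R[i] T T R[i] _ _ sub_inner
  sub_inner_bilinear.

Lemma sub_inner_herm x y :
  sub_inner x y = (-1) ^+ false * (sub_inner y x)^*.
Proof. by rewrite expr0 mul1r -innerC. Qed.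

HB.instance Definition _ := isHermitianSesquilinear.Build R[i] T false
  (@Num.conj R[i]) sub_inner sub_inner_herm.

Lemma sub_inner_gt0 x : x != 0 -> 0 < sub_inner x x.
Proof. by move=> x0; rewrite /sub_inner -sqr_norm_inner exprn_gt0 // normr_gt0. Qed.

HB.instance Definition _ := isDotProduct.Build R[i] T sub_inner sub_inner_gt0.

Lemma sub_sqr_norm x : `|x| ^+ 2 = sub_inner x x.
Proof. by rewrite snormE sqr_norm_inner. Qed.

HB.instance Definition _ := CompleteNormedModule_isHilbert.Build R T sub_sqr_norm.

End SubspaceHilbert.

Definition csub_hilbert (R : realType) (H : hilbertType R) (M : csubspace H) :
  hilbertType R := sub_of M.
Coercion csub_hilbert : csubspace >-> Hilbert.type.

Section Subspaces.
Context {R : realType}.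
Implicit Types H K : hilbertType R.

Lemma closed_approx H (S : set H) :
  (forall x, (forall e : R[i], 0 < e -> exists2 y, S y & `|x - y| < e) -> S x) ->
  closed S.
Proof.
move=> hS x clx; apply: hS => e e0.
have [y [Sy]] := clx _ (nbhsx_ballx x e e0).
by rewrite -ball_normE /ball_ /=; exists y.
Qed.

Section Orthocomplement.
Context {H : hilbertType R} (A : set H).

Definition orthoc_set : set H := [set x | forall a, A a -> '[x, a] = 0].

Lemma orthoc_set0 : orthoc_set 0.
Proof. by move=> a _; rewrite inner0l. Qed.

Lemma orthoc_set_linear (c : R[i]) x y :
  orthoc_set x -> orthoc_set y -> orthoc_set (c *: x + y).
Proof.
by move=> Ax Ay a Aa; rewrite innerDl innerZl Ax // Ay // mulr0 addr0.
Qed.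

Lemma orthoc_set_closed : closed orthoc_set.
Proof.
apply: closed_approx => x hx a Aa; apply/eqP/negPn/negP => n0.
have a0 : 0 < `|a|.
  rewrite normr_gt0; apply: contra_neq n0 => ->; exact: linear0r.
have e0 : 0 < `|'[x, a]| / `|a| by rewrite divr_gt0 // normr_gt0.
have [y Ay] := hx _ e0; rewrite ltr_pdivlMr // => /(le_lt_trans _).
move=> /(_ _ (CauchySchwarz_inner _ _)).
by rewrite innerBl (Ay _ Aa) subr0 ltxx.
Qed.

Definition orthoc : csubspace H :=
  CSubspace orthoc_set0 orthoc_set_linear orthoc_set_closed.

End Orthocomplement.

Section KernelRange.
Context {H K : hilbertType R} (T : 'B(H, K)).

Definition kernel_set : set H := [set x | T x = 0].

Lemma kernel_set0 : kernel_set 0.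
Proof. exact: linear0. Qed.

Lemma kernel_set_linear (c : R[i]) x y :
  kernel_set x -> kernel_set y -> kernel_set (c *: x + y).
Proof. by rewrite /kernel_set /= linearP => -> ->; rewrite scaler0 addr0. Qed.

Lemma kernel_set_closed : closed kernel_set.
Proof.
have [C C0 hC] := bop_pos_bound T.
apply: closed_approx => x hx; apply/eqP/negPn/negP => n0.
have e0 : 0 < `|T x| / C by rewrite divr_gt0 // normr_gt0.
have [y Ty] := hx _ e0; rewrite ltr_pdivlMr // mulrC => /(le_lt_trans (hC _)).
by rewrite linearB Ty subr0 ltxx.
Qed.

Definition kernel : csubspace H :=
  CSubspace kernel_set0 kernel_set_linear kernel_set_closed.

Lemma closure_range0 : closure (range T) 0.
Proof. by apply: subset_closure; exists 0; rewrite ?linear0. Qed.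

Lemma closure_range_linear (c : R[i]) x y :
  closure (range T) x -> closure (range T) y -> closure (range T) (c *: x + y).
Proof.
have approx z : closure (range T) z -> forall e : R[i], 0 < e ->
    exists u, `|z - T u| < e.
  move=> clz e e0; have [_ [[u _ <-]]] := clz _ (nbhsx_ballx z e e0).
  by rewrite -ball_normE /ball_ /=; exists u.
move=> /approx hx /approx hy U; rewrite -nbhs_ballE => -[e /= e0 eU].
have c0 : 0 < `|c| + 1 by rewrite ltr_wpDl.
have [u hu] := hx _ (divr_gt0 (divr_gt0 e0 (ltr0Sn _ 1)) c0).
have [v hv] := hy _ (divr_gt0 e0 (ltr0Sn _ 1)).
exists (T (c *: u + v)); split; first by exists (c *: u + v).
apply: eU; rewrite -ball_normE /ball_ /= linearP opprD addrACA -scalerBr.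
rewrite (le_lt_trans (ler_normD _ _)) // [ltRHS]splitr ltrD // normrZ.
move: hu; rewrite ltr_pdivlMr // => /(le_lt_trans _); apply.
by rewrite mulrC ler_wpM2l // lerDl.
Qed.

Definition closed_range : csubspace K :=
  CSubspace closure_range0 closure_range_linear (@closed_closure _ _).

End KernelRange.

Section IdempotentRange.
Context {H : hilbertType R} (P : 'B(H)) (hP : idempotent_fun P).

Lemma idem_range0 : range P 0.
Proof. by exists 0; rewrite ?linear0. Qed.

Lemma idem_range_linear (c : R[i]) x y :
  range P x -> range P y -> range P (c *: x + y).
Proof. by move=> [u _ <-] [v _ <-]; exists (c *: u + v); rewrite ?linearP. Qed.

Lemma idem_range_closed : closed (range P).
Proof.
have [C C0 hC] := bop_pos_bound P.
apply: closed_approx => x hx; exists x => //.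
apply/eqP; rewrite -subr_eq0; apply/negPn/negP => n0.
have C1 : 0 < C + 1 by rewrite addr_gt0.
have e0 : 0 < `|P x - x| / (C + 1) by rewrite divr_gt0 // normr_gt0.
have [_ [u _ <-]] := hx _ e0; rewrite ltr_pdivlMr //.
rewrite mulrC mulrDl mul1r => /(le_lt_trans (lerD (hC _) (lexx _))).
rewrite linearB /= (hP u : P (P u) = P u) [X in _ + X]distrC.
move=> /(le_lt_trans (ler_normD _ _)).
by rewrite addrA subrK ltxx.
Qed.

Definition idem_range : csubspace H :=
  CSubspace idem_range0 idem_range_linear idem_range_closed.

End IdempotentRange.

Section Decompositions.
Context {H : hilbertType R}.

(* T = ((A, B), (C, D)) with respect to the decomposition of H as the
   orthogonal sum of M and its orthogonal complement. *)
Definition block_form (M : csubspace H)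
    (A : M -> M) (B : orthoc (sset M) -> M)
    (C : M -> orthoc (sset M)) (D : orthoc (sset M) -> orthoc (sset M))
    (T : H -> H) :=
  forall (x : M) (y : orthoc (sset M)),
    T (val x + val y) = val (A x + B y) + val (C x + D y).

(* T = A (+) B, for H the orthogonal sum of M and M', and K that of N and N' *)
Definition direct_sum_op (K : hilbertType R) (M M' : csubspace H)
    (N N' : csubspace K) (A : M -> N) (B : M' -> N') (T : H -> K) :=
  forall (x : M) (y : M'), T (val x + val y) = val (A x) + val (B y).

(* g = A f, where A is only defined on the subspace N; this includes that the
   values of f lie in N. *)
Definition comp_sub (S T : Type) (N : csubspace H)
    (A : N -> T) (f : S -> H) (g : S -> T) :=
  forall s, exists2 z : N, val z = f s & g s = A z.

End Decompositions.

Definition orthonormal_basis H (E : set H) :=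
  (forall x y, E x -> E y -> '[x, y] = (x == y)%:R) /\
  (forall x, (forall e, E e -> '[x, e] = 0) -> x = 0).

(* The Hilbert space dimension is the cardinality of an orthonormal basis. *)
Definition same_dim H K :=
  exists (E : set H) (F : set K),
    [/\ orthonormal_basis E, orthonormal_basis F & E #= F].

End Subspaces.

(* Main.v *)
Require Import Defs.
From HB Require Import structures.
From mathcomp Require Import all_boot all_order all_algebra.
From mathcomp Require Import sesquilinear complex.
From mathcomp Require Import mathcomp_extra boolp classical_sets functions.
From mathcomp Require Import cardinality reals topology normedtype.
From mathcomp Require Import ring lra.

Set Implicit Arguments.
Unset Strict Implicit.
Unset Printing Implicit Defensive.

Import Order.TTheory GRing.Theory Num.Theory.
Import numFieldNormedType.Exports.

Local Open Scope classical_set_scope.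
Local Open Scope ring_scope.

(** The plan is to read off the block structure of [J], and then to recognise
    the two halves of [U] in a polar decomposition.

    Evaluating [J P J = I - P^*] on the range of [P] and on its orthogonal
    complement, which is the null space of [P^*], shows that [J] exchanges the
    two subspaces: if [P^* y = 0] then [J P J y = y], so [P] fixes [J y]; and
    [P^*] kills [J P x] because [J P J (J P x) = J P x].  Hence [J] is block
    antidiagonal, and [U x := i J x] is a unitary operator from [R(P)] onto
    [R(P)^perp], with inverse [U^* y = - i J y].  It transports an orthonormal
    basis, whence the equality of dimensions.  The remaining content of the
    hypothesis is that [S := U P1] is self-adjoint on [R(P)^perp]
    ([symmetry_block_skew]).

    Let [Q] be the positive square root of [P1^* P1] and [P1 = V Q] the polar
    decomposition, with [V] a partial isometry that vanishes on [N(P1)].  As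
    [U] is unitary, [S^2 = S^* S = P1^* P1], so [S] commutes with [P1^* P1] and
    therefore with [Q].  From [S = (U V) Q] one gets that [U V] commutes with
    [Q], and then [Q (U V) = S = S^* = Q (U V)^*]; as [U V] and its adjoint
    take their values in [N(P1)^perp], where [Q] is injective, [U V] is
    self-adjoint ([polar_unitary_sym]).  Being isometric on [N(P1)^perp], it
    restricts to a symmetry [J1] there, and [U V = J1] yields [U = J1 V^*] on
    the closure of [R(P1)].  On [R(P1)^perp], self-adjointness of [U P1] alone
    shows that [U] maps onto [N(P1)].

    Two analytic facts support this.  [riesz_along] represents a functional that
    is bounded with respect to a seminorm [|B x|] as an inner product with a
    vector of the closure of the range of [B].  With [B] the identity it gives
    adjoints, with [B] arbitrary it gives orthogonal projections onto closures
    of ranges, and for two operators with the same Gram form it gives the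
    partial isometry between their ranges.  [sqrt_fixpoint] gives, for a
    self-adjoint contraction [B], an operator [L] with [(I - L)^2 = I - B], as a
    uniform limit of polynomials in [B], so that it commutes with whatever
    commutes with [B]; after scaling, [I - B] is [P1^* P1]. *)

(** * Real parts of norms and inner products *)

Section RealParts.
Context {R : realType}.

Lemma ReD (a b : R[i]) : complex.Re (a + b) = complex.Re a + complex.Re b.
Proof. by case: a; case: b. Qed.

Lemma ReN (a : R[i]) : complex.Re (- a) = - complex.Re a.
Proof. by case: a. Qed.

Lemma ReZ (t : R) (a : R[i]) : complex.Re (t%:C%C * a) = t * complex.Re a.
Proof. by case: a => a b /=; rewrite mul0r subr0. Qed.

Lemma ReJ (a : R[i]) : complex.Re a^* = complex.Re a.
Proof. by case: a. Qed.

Lemma conjcR (t : R) : (t%:C%C : R[i])^* = t%:C%C.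
Proof. exact: conjc_real. Qed.

Lemma Re_iM (a : R[i]) : complex.Re ('i%C * a) = - complex.Im a.
Proof. by rewrite mulrC ReiNIm. Qed.

(** A complex-linear identity follows from the real part of it, applied to a vector
    and to [i] times that vector. *)
Lemma Re_inj (a b : R[i]) :
  complex.Re a = complex.Re b -> complex.Re ('i%C * a) = complex.Re ('i%C * b) ->
  a = b.
Proof.
by rewrite !Re_iM; case: a b => [x y] [x' y'] /= -> /oppr_inj ->.
Qed.

End RealParts.

Section RealInner.
Context {R : realType} {H : hilbertType R}.
Implicit Types (x y z : H) (t : R).

Definition rnorm x : R := complex.Re `|x|.
Definition rinner x y : R := complex.Re '[x, y].

Lemma rnormE x : `|x| = (rnorm x)%:C%C.
Proof. by rewrite /rnorm RRe_real //; apply: ger0_real. Qed.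

Lemma rnorm_ge0 x : 0 <= rnorm x.
Proof. by rewrite -lecR -rnormE; exact: normr_ge0. Qed.

Lemma rnorm_eq0 x : rnorm x = 0 -> x = 0.
Proof. by move=> x0; apply: normr0_eq0; rewrite rnormE x0. Qed.

Lemma rnorm0 : rnorm (0 : H) = 0.
Proof. by rewrite /rnorm normr0. Qed.

Lemma rnormN x : rnorm (- x) = rnorm x.
Proof. by rewrite /rnorm normrN. Qed.

Lemma rnormD x y : rnorm (x + y) <= rnorm x + rnorm y.
Proof. by rewrite -lecR rmorphD /= -!rnormE ler_normD. Qed.

Lemma rnormB x y : rnorm (x - y) = rnorm (y - x).
Proof. by rewrite -rnormN opprB. Qed.

Lemma rnorm_scale a x : rnorm (a *: x) = complex.Re `|a| * rnorm x.
Proof. by rewrite /rnorm normrZ -ReZ RRe_real // normr_real. Qed.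

Lemma rnormZ t x : 0 <= t -> rnorm (t%:C%C *: x) = t * rnorm x.
Proof. by move=> t0; rewrite rnorm_scale ger0_norm ?lecR. Qed.

Lemma inner_sqr x : '[x, x] = (rnorm x ^+ 2)%:C%C.
Proof. by rewrite -sqr_norm_inner rnormE -rmorphXn. Qed.

Lemma rinner_sqr x : rinner x x = rnorm x ^+ 2.
Proof. by rewrite /rinner inner_sqr. Qed.

Lemma rinnerC x y : rinner x y = rinner y x.
Proof. by rewrite /rinner innerC ReJ. Qed.

Lemma rinnerDl x y z : rinner (x + y) z = rinner x z + rinner y z.
Proof. by rewrite /rinner innerDl ReD. Qed.

Lemma rinnerDr x y z : rinner z (x + y) = rinner z x + rinner z y.
Proof. by rewrite /rinner innerDr ReD. Qed.

Lemma rinnerZl t x y : rinner (t%:C%C *: x) y = t * rinner x y.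
Proof. by rewrite /rinner innerZl ReZ. Qed.

Lemma rinnerZr t x y : rinner x (t%:C%C *: y) = t * rinner x y.
Proof. by rewrite rinnerC rinnerZl rinnerC. Qed.

Lemma rinnerNl x y : rinner (- x) y = - rinner x y.
Proof. by rewrite /rinner linearNl ReN. Qed.

Lemma rinnerNr x y : rinner x (- y) = - rinner x y.
Proof. by rewrite rinnerC rinnerNl rinnerC. Qed.

Lemma rinner_le x y : rinner x y <= rnorm x * rnorm y.
Proof.
rewrite -lecR rmorphM /= -!rnormE (le_trans _ (CauchySchwarz_inner x y)) //.
by rewrite (le_trans _ (normc_ge_Re _)) // lecR ler_norm.
Qed.

Lemma rnorm_sqrD x y :
  rnorm (x + y) ^+ 2 = rnorm x ^+ 2 + 2 * rinner x y + rnorm y ^+ 2.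
Proof.
rewrite -!rinner_sqr rinnerDl !rinnerDr (rinnerC y x); ring.
Qed.

Lemma innerNl x y : '[- x, y] = - '[x, y].
Proof. exact: linearNl. Qed.

Lemma inner0r x : '[x, 0] = 0.
Proof. exact: linear0r. Qed.

Lemma inner_eq0 x : '[x, x] = 0 -> x = 0.
Proof. by rewrite -sqr_norm_inner => /eqP; rewrite sqrf_eq0 normr_eq0 => /eqP. Qed.

Lemma eq_inner x y : (forall z, '[x, z] = '[y, z]) -> x = y.
Proof.
move=> xy; apply/eqP; rewrite -subr_eq0; apply/eqP/inner_eq0.
by rewrite innerBl xy subrr.
Qed.

Lemma inner_swap0 x y : '[x, y] = 0 -> '[y, x] = 0.
Proof. by rewrite (innerC y) => ->; rewrite rmorph0. Qed.

End RealInner.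

Section Epsilon.
Context {R : realType}.

(** Inequalities and equations pass to limits in this form: they are derived from
    approximate versions with an error linear in [e]. *)
Lemma le_epsP (a b c : R) : (forall e, 0 < e -> a <= b + c * e) -> a <= b.
Proof.
move=> h; apply/ler_addgt0Pr => d d0.
have c0 : 0 < `|c| + 1 by apply: ltr_wpDl.
rewrite (le_trans (h _ (divr_gt0 d0 c0))) // lerD2l mulrCA ger_pMr //.
by rewrite ler_pdivrMr // mul1r (le_trans (ler_norm c)) // lerDl.
Qed.

End Epsilon.

Section EpsilonEquality.
Context {R : realType}.

Lemma rnorm_eps_eq0 (H : hilbertType R) (x : H) (c : R) :
  (forall e, 0 < e -> rnorm x <= c * e) -> x = 0.
Proof.
move=> h; apply: rnorm_eq0; apply/eqP; rewrite eq_le rnorm_ge0 andbT.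
by apply: (@le_epsP _ _ _ c) => e e0; rewrite add0r h.
Qed.

Lemma normc_eps_eq0 (z : R[i]) (c : R) :
  (forall e, 0 < e -> `|z| <= (c * e)%:C%C) -> z = 0.
Proof.
move=> h; apply/eqP; rewrite -normr_eq0.
have zE : `|z| = (complex.Re `|z|)%:C%C by rewrite RRe_real // ger0_real.
suff : complex.Re `|z| <= 0.
  by rewrite -lecR -zE => z0; rewrite eq_le z0 normr_ge0.
by apply: (@le_epsP _ _ _ c) => e e0; rewrite add0r -lecR -zE h.
Qed.

(** A real quadratic function that is minimal at [0] has derivative [0] there; this
    serves as the first variation in minimisation arguments. *)
Lemma linear_form_eq0 (D N : R) :
  0 <= N -> (forall t, 0 <= 2 * t * D + t ^+ 2 * N) -> D = 0.
Proof.
move=> N0 quad; have N1 : 0 < N + 1 by lra.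
have := quad (- (D / (N + 1))).
have -> : 2 * (- (D / (N + 1))) * D + (- (D / (N + 1))) ^+ 2 * N =
    - (D ^+ 2 * (N + 2) / (N + 1) ^+ 2) by field; lra.
rewrite oppr_ge0 pmulr_lle0 ?invr_gt0 ?exprn_gt0 //.
rewrite pmulr_lle0 ?(ltr_wpDl N0) // => D2.
by apply/eqP; rewrite -sqrf_eq0 eq_le D2 sqr_ge0.
Qed.

End EpsilonEquality.

(** * Completeness and the Riesz representation theorem *)

Section Completeness.
Context {R : realType} {H : hilbertType R}.

Lemma ex_invn_lt (e : R) : 0 < e -> exists n : nat, n.+1%:R^-1 < e.
Proof. by move=> /ltr_add_invr[n]; rewrite add0r; exists n. Qed.

(** Nested sets whose diameters tend to zero generate a Cauchy filter.  This is the
    only place where completeness is used, for minimising sequences as well as for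
    the iteration that converges to a square root. *)
Lemma cantor_intersection (A : nat -> set H) (e : nat -> R) :
  (forall n, A n !=set0) ->
  (forall m n, (m <= n)%N -> A n `<=` A m) ->
  (forall n x y, A n x -> A n y -> rnorm (x - y) <= e n) ->
  (forall d, 0 < d -> exists n, e n < d) ->
  exists l, forall n x, A n x -> rnorm (l - x) <= e n.
Proof.
move=> A0 Ale Ae e0.
have FF : ProperFilter (filter_from setT A).
  apply: filter_from_proper => //; apply: filter_from_filter; first by exists 0%N.
  move=> i j _ _; exists (maxn i j) => // x Ax.
  by split; apply: Ale Ax; rewrite (leq_maxl, leq_maxr).
have toR (d : R[i]) : 0 < d -> exists2 r : R, 0 < r & d = r%:C%C.
  by case: d => a b; rewrite ltcE /= => /andP[/eqP -> a0]; exists a.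
have /cauchy_cvg/cvg_ex[l Fl] : cauchy (filter_from setT A).
  apply/cauchy_ballP => d /toR[r r0 ->]; have [n en] := e0 _ r0.
  exists (A n, A n); first by split; exists n.
  move=> [x y] [/= Ax Ay]; rewrite -ball_normE /ball_ /= rnormE ltcR.
  exact: le_lt_trans (Ae _ _ _ Ax Ay) en.
exists l => n x Ax; apply/ler_addgt0Pr => d d0.
have d0' : 0 < d%:C%C by rewrite ltcR.
have [m _ Am] := Fl _ (nbhsx_ballx l _ d0').
have [y Ay] := A0 (maxn m n).
have /Am : A m y by apply: Ale Ay; rewrite leq_maxl.
rewrite -ball_normE /ball_ /= rnormE ltcR => ly.
have Any : A n y by apply: Ale Ay; rewrite leq_maxr.
have -> : l - x = (y - x) + (l - y) by rewrite [RHS]addrC addrA subrK.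
by rewrite (le_trans (rnormD _ _)) // lerD ?Ae // ltW.
Qed.

Lemma closure_rangeP (E : Type) (B : E -> H) v :
  closure (range B) v <-> forall e : R, 0 < e -> exists x, rnorm (v - B x) < e.
Proof.
split=> [cv e e0|h U].
  have e0' : 0 < e%:C%C by rewrite ltcR.
  have [_ [[x _ <-]]] := cv _ (nbhsx_ballx v _ e0').
  by rewrite -ball_normE /ball_ /= rnormE ltcR; exists x.
rewrite -nbhs_ballE => -[[a b]]; rewrite /= ltcE /= => /andP[/eqP -> a0] eU.
have [x vx] := h _ a0; exists (B x); split; first by exists x.
by apply: eU; rewrite -ball_normE /ball_ /= rnormE ltcR.
Qed.

(** The vector is obtained by minimising the real functional
    [|B x|^2 - 2 Re (f x)] over [E]: by the parallelogram law almost minimal [x]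
    have almost equal images [B x], so that these converge, and varying an almost
    minimal [x] along [t z] gives the equation for the limit.  Only the images
    [B x] converge, so the limit lies in the closure of the range of [B]. *)
Lemma riesz_along (E : lmodType R[i]) (B : {linear E -> H}) (f : E -> R[i]) (c : R) :
  (forall x y, f (x + y) = f x + f y) -> (forall a x, f (a *: x) = a * f x) ->
  0 <= c -> (forall x, `|f x| <= c%:C%C * `|B x|) ->
  exists v, [/\ closure (range B) v, forall x, f x = '[B x, v] & rnorm v <= c].
Proof.
move=> fD fZ c0 fc.
pose g x := complex.Re (f x); pose q x := rnorm (B x) ^+ 2 - 2 * g x.
have gc x : g x <= c * rnorm (B x).
  rewrite -lecR rmorphM /= -rnormE (le_trans _ (fc x)) //.
  by rewrite (le_trans _ (normc_ge_Re _)) // lecR ler_norm.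
have gD x y : g (x + y) = g x + g y by rewrite /g fD ReD.
have gZ t x : g (t%:C%C *: x) = t * g x by rewrite /g fZ ReZ.
have q_ge x : - c ^+ 2 <= q x.
  by rewrite /q; have := gc x; have := sqr_ge0 (rnorm (B x) - c); nra.
have hinf : has_inf (range q).
  by split; [exists (q 0), 0|exists (- c ^+ 2) => _ [x _ <-]].
set d := inf (range q).
have d_le x : d <= q x by apply: ge_inf; [exact: hinf.2|exists x].
pose r n : R := n.+1%:R^-1.
have r0 n : 0 < r n by rewrite invr_gt0.
have rle m n : (m <= n)%N -> r n <= r m.
  by move=> mn; rewrite lef_pV2 ?posrE // ler_nat.
pose A n := [set B x | x in [set x | q x < d + r n ^+ 2]].
have [||||v vA] := @cantor_intersection A (fun n => 2 * r n).
- move=> n; have rn0 : 0 < r n ^+ 2 by rewrite exprn_gt0.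
  by have [_ [x _ <-] xd] := inf_adherent rn0 hinf; exists (B x), x.
- move=> m n mn _ [x /= xd <-]; exists x => //=; apply: lt_le_trans xd _.
  by rewrite lerD2l ler_pXn2r ?nnegrE ?(ltW (r0 _)) ?rle.
- move=> n _ _ [x /= xd <-] [y /= yd <-].
  have := d_le ((1 / 2)%:C%C *: (x + y)).
  rewrite /q gZ gD (linearZZ B) rnormZ; last lra.
  rewrite exprMn (linearD B) rnorm_sqrD => md.
  rewrite -(@ler_pXn2r _ 2) ?nnegrE ?rnorm_ge0 ?mulr_ge0 ?(ltW (r0 _)) //.
  move: xd yd; rewrite rnorm_sqrD rnormN rinnerNr exprMn /q; nra.
- move=> e e0; have [|n ne] := @ex_invn_lt (e / 2); first by rewrite divr_gt0.
  by exists n; rewrite mulrC -ltr_pdivlMr.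
have approx (e : R) : 0 < e -> exists x n,
    [/\ r n < e, r n <= 1, q x < d + r n ^+ 2 & rnorm (v - B x) <= 2 * r n].
  move=> e0; have [n ne] := ex_invn_lt e0.
  have rn0 : 0 < r n ^+ 2 by rewrite exprn_gt0.
  have [_ [x _ <-] xd] := inf_adherent rn0 hinf; exists x, n; split => //.
    by rewrite invf_le1 // ler1n.
  by apply: vA; exists x.
(* Re f and the real inner product with v agree; multiplying vectors by i then
   gives the complex statement. *)
have key z : g z = rinner (B z) v.
  suff quad t : 0 <= 2 * t * (rinner (B z) v - g z) + t ^+ 2 * rnorm (B z) ^+ 2.
    apply/eqP; rewrite eq_sym -subr_eq0; apply/eqP.
    exact: linear_form_eq0 (sqr_ge0 _) quad.
  apply: (@le_epsP _ _ _ (1 + 4 * `|t| * rnorm (B z))) => e e0.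
  have [x [n [ne n1 xd vx]]] := approx e e0.
  have := d_le (x + t%:C%C *: z).
  rewrite /q gD gZ (linearD B) (linearZZ B) rnorm_sqrD.
  rewrite rinnerZr -(rinner_sqr (_ *: _)) rinnerZl rinnerZr rinner_sqr.
  have : t * rinner (B z) (B x - v) <= `|t| * (rnorm (B z) * (2 * r n)).
    rewrite (le_trans (ler_norm _)) // normrM ler_wpM2l //.
    have [_|_] := ger0P (rinner _ _); rewrite -?rinnerNr ?opprB;
      rewrite (le_trans (rinner_le _ _)) // ler_wpM2l ?rnorm_ge0 //.
    by rewrite rnormB.
  rewrite rinnerDr rinnerNr (rinnerC (B x)).
  move: xd; rewrite /q; have := r0 n; have := rnorm_ge0 (B z).
  have := normr_ge0 t.
  move: (rinner (B z) (B x)) (rinner (B z) v) (g x) (g z) => a b gx gz.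
  move: (rnorm (B x)) (rnorm (B z)) (r n) `|t| n1 ne => X Z rn T.
  move=> n1 ne T0 Z0 rn0 h1 h2 h3.
  have h4 : rn ^+ 2 <= e by nra.
  have h5 : T * (Z * (2 * rn)) <= T * (Z * (2 * e)).
    by rewrite !ler_wpM2l //; lra.
  nra.
have vc : closure (range B) v.
  apply/closure_rangeP => e e0.
  have [|x [n [ne _ _ vx]]] := approx (e / 2); first by rewrite divr_gt0.
  by exists x; apply: le_lt_trans vx _; rewrite mulrC -ltr_pdivlMr.
exists v; split => //.
  move=> x; apply: Re_inj; first exact: key.
  by rewrite -fZ -innerZl -(linearZZ B); exact: key.
have : rnorm v ^+ 2 <= c * rnorm v.
  apply: (@le_epsP _ _ _ (c + rnorm v)) => e e0.
  have [x vx] := (closure_rangeP _ _).1 vc _ e0.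
  have -> : rnorm v ^+ 2 = g x + rinner (v - B x) v.
    by rewrite key -rinnerDl addrC subrK rinner_sqr.
  have := rinner_le (v - B x) v; have := gc x.
  have := rnormD v (B x - v); rewrite (addrC v) subrK rnormB.
  by have := rnorm_ge0 v; nra.
by have := rnorm_ge0 v; nra.
Qed.

End Completeness.

(** * Adjoints, ranges and partial isometries *)

Section Operators.
Context {R : realType}.
Implicit Types H K : hilbertType R.

Lemma eq_innerr H (x y : H) : (forall z, '[z, x] = '[z, y]) -> x = y.
Proof. by move=> xy; apply: eq_inner => z; rewrite innerC xy -innerC. Qed.

Lemma bop_bound H K (T : 'B(H, K)) :
  exists2 c : R, 0 <= c & forall x, rnorm (T x) <= c * rnorm x.
Proof.
have [[c d]] := bop_pos_bound T.
rewrite ltcE /= => /andP[/eqP -> /ltW c0] Tc; exists c => // x.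
by rewrite -lecR rmorphM /= -!rnormE.
Qed.

Lemma bop_of_fun H K (f : H -> K) (c : R) :
  (forall a x y, f (a *: x + y) = a *: f x + f y) ->
  (forall x, rnorm (f x) <= c * rnorm x) ->
  exists T : 'B(H, K), forall x, T x = f x.
Proof.
move=> f_lin fc.
pose l := GRing.isLinear.Build R[i] H K _ f f_lin.
pose F : {linear H -> K} := HB.pack f l.
have Fb : exists C : R[i], forall x, `|F x| <= C * `|x|.
  by exists c%:C%C => x; rewrite !rnormE -rmorphM lecR.
by exists (BoundedOp Fb).
Qed.

Lemma adj_exists H K (T : 'B(H, K)) :
  exists S : 'B(K, H), forall x y, '[T x, y] = '[x, S y].
Proof.
have [c c0 Tc] := bop_bound T.
have /choice[S TS] (y : K) : exists v,
    (forall x, '[T x, y] = '[x, v]) /\ rnorm v <= c * rnorm y.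
  have [|||x|v [_ vT vc]] :=
    @riesz_along R H H idfun (fun x => '[T x, y]) (c * rnorm y).
  - by move=> x z; rewrite linearD innerDl.
  - by move=> a x; rewrite linearZZ innerZl.
  - by rewrite mulr_ge0 ?rnorm_ge0.
  - rewrite (le_trans (CauchySchwarz_inner _ _)) //= !rnormE -!rmorphM lecR mulrAC.
    by rewrite ler_wpM2r ?rnorm_ge0.
  by exists v.
have [] := @bop_of_fun _ _ S c.
- move=> a x y; apply: eq_innerr => z; rewrite -(TS _).1 !innerDr !innerZr.
  by rewrite !(TS _).1.
- by move=> x; exact: (TS x).2.
by move=> S' S'E; exists S' => x y; rewrite S'E; exact: (TS y).1.
Qed.

Lemma adjP H K (T : 'B(H, K)) x y : '[T x, y] = '[x, adj T y].
Proof. exact: (xgetPex bop0 (adj_exists T)). Qed.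

Lemma adjPr H K (T : 'B(H, K)) x y : '[y, T x] = '[adj T y, x].
Proof. by rewrite innerC adjP -innerC. Qed.

Lemma adj_unique H K (T : 'B(H, K)) (S : K -> H) :
  (forall x y, '[T x, y] = '[x, S y]) -> adj T =1 S.
Proof. by move=> TS y; apply: eq_innerr => z; rewrite -adjP. Qed.

(** The orthogonal projection of [y] onto the closure of the range, together with
    its characteristic property. *)
Lemma range_decomp H K (T : 'B(H, K)) y : exists2 u,
  closure (range T) u & forall x, '[T x, y - u] = 0.
Proof.
have [|||x|u [Tu yu _]] := @riesz_along R K H T (fun x => '[T x, y]) (rnorm y).
- by move=> x z; rewrite linearD innerDl.
- by move=> a x; rewrite linearZZ innerZl.
- exact: rnorm_ge0.
- by rewrite mulrC -rnormE CauchySchwarz_inner.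
by exists u => // x; rewrite innerBr yu subrr.
Qed.

Lemma closure_range_orthogonal H K (T : 'B(H, K)) y w :
  closure (range T) y -> (forall x, '[T x, w] = 0) -> '[y, w] = 0.
Proof.
move=> Ty Tw; have : closure (orthoc_set [set w]) y.
  by apply: closureS Ty => _ [x _ <-] _ ->.
by rewrite -(closure_id _).1; [exact|exact: orthoc_set_closed].
Qed.

(** The converse of [closure_range_orthogonal]; together they say that the closure
    of a range is its double orthogonal complement. *)
Lemma closure_rangeE H K (T : 'B(H, K)) y :
  (forall w, (forall x, '[T x, w] = 0) -> '[y, w] = 0) -> closure (range T) y.
Proof.
move=> yT; have [u Tu yu] := range_decomp T y.
suff /eqP : y - u = 0 by rewrite subr_eq0 => /eqP ->.
by apply: inner_eq0; rewrite innerBl yT // (closure_range_orthogonal Tu) ?subrr.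
Qed.

Lemma closure_range_eq0 H K (T : 'B(H, K)) y :
  closure (range T) y -> (forall x, '[T x, y] = 0) -> y = 0.
Proof. by move=> Ty yT; apply: inner_eq0; exact: closure_range_orthogonal Ty yT. Qed.

Lemma eq_bop_closure H K L (T : 'B(H, K)) (A B : 'B(K, L)) :
  (forall x, A (T x) = B (T x)) -> forall y, closure (range T) y -> A y = B y.
Proof.
move=> AB y Ty; apply: eq_inner => z; rewrite !adjP.
apply/eqP; rewrite -subr_eq0 -innerBr; apply/eqP.
by apply: closure_range_orthogonal Ty _ => x; rewrite innerBr -!adjP AB subrr.
Qed.

(** The space is the sum of the closure of the range and of the orthogonal
    complement of the range. *)
Lemma eq_bop_range H K L (T : 'B(H, K)) (A B : 'B(K, L)) :
  (forall x, A (T x) = B (T x)) ->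
  (forall w, (forall x, '[T x, w] = 0) -> A w = B w) -> A =1 B.
Proof.
move=> AB AB' y; have [u Tu yu] := range_decomp T y.
by rewrite -(subrK u y) (linearD A) (linearD B) AB' // (eq_bop_closure AB Tu).
Qed.

Lemma bop_id H : exists I : 'B(H), forall x, I x = x.
Proof. by apply: (@bop_of_fun _ _ id 1) => [//|x]; rewrite mul1r. Qed.

Lemma bop_scale H K (a : R[i]) (T : 'B(H, K)) :
  exists S : 'B(H, K), forall x, S x = a *: T x.
Proof.
have [c c0 Tc] := bop_bound T.
apply: (@bop_of_fun _ _ (fun x => a *: T x) (complex.Re `|a| * c)) => [b x y|x].
  by rewrite linearP scalerDr !scalerA mulrC.
rewrite rnorm_scale -mulrA ler_wpM2l // -lecR RRe_real ?normr_real //.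
exact: normr_ge0.
Qed.

Lemma bop_comp H K L (A : 'B(K, L)) (B : 'B(H, K)) :
  exists T : 'B(H, L), forall x, T x = A (B x).
Proof.
have [[a a0 Aa] [b b0 Bb]] := (bop_bound A, bop_bound B).
apply: (@bop_of_fun _ _ (fun x => A (B x)) (a * b)) => [c x y|x].
  by rewrite !linearP.
by rewrite (le_trans (Aa _)) // -mulrA ler_wpM2l.
Qed.

(** The value [V w] represents the functional [B x |-> <A x, w>] on the range of [B],
    which is bounded by [|w|] because [|A x| = |B x|].  In this way [V] is defined on
    the whole space at once, without an extension by continuity. *)
Lemma partial_isometry H K L (A : 'B(H, K)) (B : 'B(H, L)) :
  (forall x y, '[A x, A y] = '[B x, B y]) ->
  exists V : 'B(K, L), [/\ forall x, V (A x) = B x, forall x, adj V (B x) = A x,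
    forall w, (forall x, '[A x, w] = 0) -> V w = 0 &
    forall w, closure (range B) (V w)].
Proof.
move=> AB; have AB_norm x : rnorm (A x) = rnorm (B x).
  apply/eqP; rewrite -(@eqrXn2 _ 2) ?rnorm_ge0 //; apply/eqP.
  by rewrite -!rinner_sqr /rinner AB.
have /choice[V /all_and3[VB VA Vn]] (w : K) : exists v, [/\ closure (range B) v,
    forall x, '[A x, w] = '[B x, v] & rnorm v <= rnorm w].
  apply: (@riesz_along R L H B (fun x => '[A x, w]) (rnorm w)).
  - by move=> x z; rewrite linearD innerDl.
  - by move=> a x; rewrite linearZZ innerZl.
  - exact: rnorm_ge0.
  - move=> x; rewrite mulrC -rnormE (rnormE (B x)) -AB_norm -rnormE.
    exact: CauchySchwarz_inner.
have [||V' V'E] := @bop_of_fun _ _ V 1.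
- move=> a x y; apply/eqP; rewrite -subr_eq0; apply/eqP.
  apply: (@closure_range_eq0 _ _ B) => [|z].
    rewrite addrC -scaleN1r; apply: closure_range_linear => //.
    exact: closure_range_linear.
  by rewrite innerBr innerDr innerZr -!VA innerDr innerZr subrr.
- by move=> x; rewrite mul1r.
have VAB x : V' (A x) = B x.
  rewrite V'E; apply/eqP; rewrite -subr_eq0; apply/eqP.
  apply: (@closure_range_eq0 _ _ B) => [|z].
    rewrite addrC -scaleN1r; apply: closure_range_linear => //.
    by apply: subset_closure; exists x.
  by rewrite innerBr -VA AB subrr.
have V0 w : (forall x, '[A x, w] = 0) -> V' w = 0.
  move=> Aw; rewrite V'E; apply: (@closure_range_eq0 _ _ B) => // x.
  by rewrite -VA Aw.
exists V'; split => // [x|w]; last by rewrite V'E.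
apply: eq_innerr => z; rewrite -adjP.
have [u Au zu] := range_decomp A z.
rewrite -(subrK u z) (linearD V') (V0 _ zu) add0r innerDl.
rewrite [X in _ = X + _]inner_swap0 // add0r.
apply/eqP; rewrite -subr_eq0 adjP -innerBr; apply/eqP.
apply: closure_range_orthogonal Au _ => y.
by rewrite innerBr -adjP VAB AB subrr.
Qed.

Section SubspaceElements.
Context {H : hilbertType R}.
Implicit Types M : csubspace H.

Lemma csub_mem M (x : M) : sset M (val x).
Proof. by case: x => x /= /asboolP. Qed.

Lemma csub_ex M x : sset M x -> exists z : M, val z = x.
Proof. by move=> Mx; exists (SubOf (asboolT Mx)). Qed.

Lemma csub_inner M (x y : M) : '[x, y] = '[val x, val y].
Proof. by []. Qed.

Lemma csub_valP M (a : R[i]) (x y : M) : val (a *: x + y) = a *: val x + val y.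
Proof. by rewrite linearP. Qed.

End SubspaceElements.

Lemma restriction H K (M : csubspace H) (N : csubspace K) (T : 'B(H, K)) :
  (forall x, sset M x -> sset N (T x)) ->
  exists S : 'B(M, N), forall x, val (S x) = T (val x).
Proof.
move=> MN; have /choice[S ST] (x : M) : exists z : N, val z = T (val x).
  by apply: csub_ex; apply: MN; exact: csub_mem.
have [c c0 Tc] := bop_bound T.
have [|x|S' S'E] := @bop_of_fun M N S c.
- by move=> a x y; apply: val_inj; rewrite csub_valP !ST csub_valP linearP.
- by rewrite /rnorm /= !snormE ST; exact: Tc.
by exists S' => x; rewrite S'E.
Qed.

(** [T'] is only assumed to be a formal adjoint of [T], so that the lemma applies to a
    unitary operator given with its inverse. *)
Lemma adj_restriction H K (M : csubspace H) (N : csubspace K) (T : 'B(H, K))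
    (T' : K -> H) (S : 'B(M, N)) (S' : 'B(N, M)) :
  (forall x y, '[T x, y] = '[x, T' y]) ->
  (forall x, val (S x) = T (val x)) -> (forall y, val (S' y) = T' (val y)) ->
  adj S =1 S'.
Proof.
by move=> TT' ST S'T'; apply: adj_unique => x y; rewrite !csub_inner ST S'T'.
Qed.

End Operators.

(** * Square roots by iteration *)

Section SquareRoot.
Context {R : realType}.
Implicit Types H K : hilbertType R.

Section Iteration.
Context {H : hilbertType R} (B : 'B(H)).
Context (B_sym : forall x y, '[B x, y] = '[x, B y]).
Context (B_le1 : forall x, rnorm (B x) <= rnorm x).

Local Notation h := (1 / 2 : R).

Let h0 : 0 <= h. Proof. by lra. Qed.

(** If [L] is a fixed point of [Y |-> (B + Y^2) / 2] then [(I - L)^2 = I - B], so the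
    limit of this iteration provides the square root of [I - B]. *)
Fixpoint sqrt_iter n x : H :=
  if n is m.+1 then h%:C%C *: (B x + sqrt_iter m (sqrt_iter m x)) else 0.

(** The same iteration for the scalar [1] in place of [B]: it increases to [1], and
    it dominates the operators [sqrt_iter n] as well as their increments. *)
Fixpoint sqrt_iter_bound n : R :=
  if n is m.+1 then (1 + sqrt_iter_bound m ^+ 2) / 2 else 0.

Local Notation Y := sqrt_iter.
Local Notation y := sqrt_iter_bound.

Lemma sqrt_iter_bound_itv n : 0 <= y n <= 1.
Proof.
elim: n => [|n /andP[y0 y1]] /=; first by rewrite lexx ler01.
have := sqr_ge0 (y n) => y2; have y2' : y n ^+ 2 <= 1 by rewrite expr_le1.
by apply/andP; split; lra.
Qed.

Lemma sqrt_iter_bound_le n : y n <= y n.+1.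
Proof. rewrite /=; move: (y n) => u; have := sqr_ge0 (1 - u) => u1; nra. Qed.

(** For [e = 1 - y n] the recurrence is [e' = e - e^2 / 2], so [e (n + 2) <= 2]
    propagates. *)
Lemma sqrt_iter_bound_cvg n : 1 - y n <= 2 * n.+1%:R^-1.
Proof.
suff : (1 - y n) * (n%:R + 2) <= 2.
  rewrite ler_pdivlMr ?ltr0n // => h1.
  have /andP[_ y1] := sqrt_iter_bound_itv n.
  by move: h1; rewrite -[n.+1%:R]natr1; nra.
elim: n => [|n IH] /=; first by lra.
have /andP[y0 y1] := sqrt_iter_bound_itv n.
rewrite -[n.+1%:R]natr1; have : 0 <= (n%:R : R) by [].
move: (y n) (n%:R) IH y0 y1 => u k IH y0 y1 k0.
have h1 : (1 - u) * (k + 2) * (1 + u) <= 2 * (1 + u) by rewrite ler_wpM2r //; lra.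
by have := sqr_ge0 (1 - u); lra.
Qed.

Lemma sqrt_iterB n x z : Y n (x - z) = Y n x - Y n z.
Proof.
elim: n x z => [|n IH] x z /=; first by rewrite subr0.
by rewrite !IH linearB /= -scalerBr addrACA opprD.
Qed.

Lemma sqrt_iter_comm (T : {linear H -> H}) n x :
  (forall x, T (B x) = B (T x)) -> T (Y n x) = Y n (T x).
Proof.
move=> TB; elim: n x => [|n IH] x /=; first by rewrite linear0.
by rewrite linearZZ linearD !IH TB.
Qed.

Lemma sqrt_iter_sym n x z : '[Y n x, z] = '[x, Y n z].
Proof.
elim: n x z => [|n IH] x z /=; first by rewrite inner0l inner0r.
by rewrite innerZl innerZr conjcR innerDl innerDr B_sym !IH.
Qed.

Lemma sqrt_iter_le n x : rnorm (Y n x) <= y n * rnorm x.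
Proof.
elim: n x => [|n IH] x; first by rewrite /= rnorm0 mul0r.
rewrite [Y _ x]/= rnormZ //; have := rnormD (B x) (Y n (Y n x)).
have := B_le1 x; have := IH x; have := IH (Y n x); have := rnorm_ge0 x.
have /andP[y0 y1] := sqrt_iter_bound_itv n; rewrite /=.
move: (y n) y0 y1 => u u0 u1 a b c d e.
have : u * rnorm (Y n x) <= u * (u * rnorm x) by rewrite ler_wpM2l.
lra.
Qed.

(** With [D] the previous increment, the next one is [(Y' D + D Y) / 2], where [Y] and
    [Y'] are the last two iterates; the scalar increments satisfy the same
    identity. *)
Lemma sqrt_iter_stepB n x :
  rnorm (Y n.+1 x - Y n x) <= (y n.+1 - y n) * rnorm x.
Proof.
elim: n x => [|n IH] x.
  rewrite /= subr0 addr0 rnormZ // expr0n /= addr0 subr0.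
  by rewrite ler_wpM2l.
have -> : Y n.+2 x - Y n.+1 x = h%:C%C *: (Y n.+1 (Y n.+1 x - Y n x) +
    (Y n.+1 (Y n x) - Y n (Y n x))).
  rewrite [Y n.+2 x]/= [in X in _ - X]/= -scalerBr opprD addrACA subrr add0r.
  by rewrite -!/(Y n.+1 _) sqrt_iterB addrA subrK.
rewrite rnormZ //.
have := rnormD (Y n.+1 (Y n.+1 x - Y n x)) (Y n.+1 (Y n x) - Y n (Y n x)).
have := sqrt_iter_le n.+1 (Y n.+1 x - Y n x); have := IH x; have := IH (Y n x).
have := sqrt_iter_le n x.
have /andP[+ _] := sqrt_iter_bound_itv n.+1.
have /andP[+ _] := sqrt_iter_bound_itv n.
have := rnorm_ge0 (Y n.+1 x - Y n x).
have -> : y n.+2 - y n.+1 = h * ((y n.+1 + y n) * (y n.+1 - y n)).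
  have yS m : y m.+1 = (1 + y m ^+ 2) / 2 by [].
  by rewrite [X in X - _ = _]yS [X in _ - X = _]yS; field.
move: (rnorm (Y n.+1 _ + _)) (rnorm (Y n.+1 x - Y n x)).
move: (rnorm (Y n.+1 (Y n.+1 x - Y n x))) (rnorm (Y n.+1 (Y n x) - Y n (Y n x))).
move: (rnorm (Y n x)) (rnorm x) => yx X d2 d3 s d1.
have := sqrt_iter_bound_le n.
move: (y n) (y n.+1) => u v uv d10 u0 v0 yxX d3y d1X d2v s23.
rewrite -mulrA ler_wpM2l //.
have h1 : v * d1 <= v * ((v - u) * X) by rewrite ler_wpM2l.
have h2 : (v - u) * yx <= (v - u) * (u * X) by rewrite ler_wpM2l ?subr_ge0.
by lra.
Qed.

Lemma sqrt_iter_near n m x : (n <= m)%N ->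
  rnorm (Y m x - Y n x) <= (1 - y n) * rnorm x.
Proof.
move=> nm; suff : rnorm (Y m x - Y n x) <= (y m - y n) * rnorm x.
  move=> /le_trans -> //; rewrite ler_wpM2r ?rnorm_ge0 // lerD2r.
  by have /andP[] := sqrt_iter_bound_itv m.
elim: m nm => [|m IH].
  by rewrite leqn0 => /eqP ->; rewrite !subrr rnorm0 mul0r.
rewrite leq_eqVlt => /orP[/eqP ->|/IH nm]; first by rewrite !subrr rnorm0 mul0r.
have -> : Y m.+1 x - Y n x = (Y m.+1 x - Y m x) + (Y m x - Y n x).
  by rewrite addrA subrK.
by rewrite (le_trans (rnormD _ _)) //; have := sqrt_iter_stepB m x; lra.
Qed.

(** The convergence is uniform on bounded sets.  This uniformity is what allows
    passing to the limit in [Y n (Y n x)]. *)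
Lemma sqrt_iter_cvg : exists L : H -> H, forall e, 0 < e ->
  exists n, forall m x, (n <= m)%N -> rnorm (L x - Y m x) <= e * rnorm x.
Proof.
pose r n : R := n.+1%:R^-1.
have r0 n : 0 < r n by rewrite invr_gt0.
have y_r n : 1 - y n <= 2 * r n by exact: sqrt_iter_bound_cvg.
have /choice[L LY] (x : H) : exists l, forall n m, (n <= m)%N ->
    rnorm (l - Y m x) <= 4 * r n * rnorm x.
  pose A n := [set Y m x | m in [set m | (n <= m)%N]].
  have [||||l lA] := @cantor_intersection R H A (fun n => 4 * r n * rnorm x).
  - by move=> n; exists (Y n x), n => /=.
  - by move=> m n mn _ [k /= nk <-]; exists k => //=; exact: leq_trans nk.
  - move=> n _ _ [k /= nk <-] [k' /= nk' <-].
    have -> : Y k x - Y k' x = (Y k x - Y n x) + (Y n x - Y k' x).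
      by rewrite addrA subrK.
    rewrite (le_trans (rnormD _ _)) // [X in _ + X]rnormB.
    have := sqrt_iter_near x nk; have := sqrt_iter_near x nk'.
    have : (1 - y n) * rnorm x <= 2 * r n * rnorm x by rewrite ler_wpM2r ?rnorm_ge0.
    by lra.
  - move=> e e0; have c0 : 0 < 4 * (rnorm x + 1).
      by rewrite mulr_gt0 // ltr_wpDl ?rnorm_ge0.
    have [n ne] := ex_invn_lt (divr_gt0 e0 c0); exists n.
    move: ne; rewrite ltr_pdivlMr // -/(r n); have := r0 n; have := rnorm_ge0 x.
    by nra.
  by exists l => n m nm; apply: lA; exists m.
exists L => e e0; have [n ne] := ex_invn_lt (divr_gt0 e0 (ltr0Sn R 3)).
exists n => m x nm; apply: le_trans (LY x _ _ nm) _.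
rewrite ler_wpM2r ?rnorm_ge0 //; move: ne; rewrite ltr_pdivlMr // -/(r n); lra.
Qed.

(** Symmetry passes to the limit, and linearity of [L] follows from it: a map with a
    formal adjoint is linear. *)
Lemma sqrt_fixpoint : exists L : 'B(H),
  [/\ forall x z, '[L x, z] = '[x, L z], forall x, rnorm (L x) <= rnorm x,
    forall x, L (L x) = L x + L x - B x &
    forall T : 'B(H), (forall x, T (B x) = B (T x)) -> forall x, T (L x) = L (T x)].
Proof.
have [L LY] := sqrt_iter_cvg.
have Y_le1 n x : rnorm (Y n x) <= rnorm x.
  rewrite (le_trans (sqrt_iter_le n x)) // ler_piMl ?rnorm_ge0 //.
  by have /andP[] := sqrt_iter_bound_itv n.
have L_sym x z : '[L x, z] = '[x, L z].
  apply/eqP; rewrite -subr_eq0; apply/eqP.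
  apply: (@normc_eps_eq0 _ _ (2 * (rnorm x * rnorm z))) => e e0.
  have [n /(_ n)LYn] := LY _ e0.
  have -> : '[L x, z] - '[x, L z] = '[L x - Y n x, z] - '[x, L z - Y n z].
    by rewrite innerBl innerBr sqrt_iter_sym; ring.
  rewrite (le_trans (ler_normB _ _)) //.
  rewrite (le_trans (lerD (CauchySchwarz_inner _ _) (CauchySchwarz_inner _ _))) //.
  rewrite !rnormE -!rmorphM -rmorphD lecR.
  have := LYn x (leqnn n); have := LYn z (leqnn n).
  by have := rnorm_ge0 x; have := rnorm_ge0 z; nra.
have L_le1 x : rnorm (L x) <= rnorm x.
  apply: (@le_epsP _ _ _ (rnorm x)) => e e0.
  have [n /(_ n x (leqnn n))LYn] := LY _ e0.
  have := rnormD (L x - Y n x) (Y n x); rewrite subrK.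
  by have := Y_le1 n x; lra.
have [||L' L'E] := @bop_of_fun _ _ _ L 1.
- move=> a x z; apply: eq_inner => w.
  by rewrite L_sym !(innerDl, innerZl) !L_sym.
- by move=> x; rewrite mul1r.
exists L'; split => [x z|x|x|T TB x]; rewrite ?L'E //.
  apply/eqP; rewrite -subr_eq0; apply/eqP.
  apply: (@rnorm_eps_eq0 _ _ _ (4 * rnorm x)) => e e0.
  have [n LYn] := LY _ e0.
  have BE : B x = Y n.+1 x + Y n.+1 x - Y n (Y n x).
    rewrite /= -scalerDl -rmorphD /= (_ : 1 / 2 + 1 / 2 = 1) ?scale1r ?addrK //.
    by field.
  have -> : L (L x) - (L x + L x - B x) = (L (L x) - Y n (L x)) +
      Y n (L x - Y n x) - (L x - Y n.+1 x) - (L x - Y n.+1 x).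
    rewrite BE sqrt_iterB; apply: eq_inner => w.
    by rewrite !(innerDl, innerNl); ring.
  have := rnormD (L (L x) - Y n (L x)) (Y n (L x - Y n x)).
  set a := _ + Y n _; have := rnormD a (- (L x - Y n.+1 x)).
  have := rnormD (a - (L x - Y n.+1 x)) (- (L x - Y n.+1 x)); rewrite !rnormN.
  have := LYn n (L x) (leqnn n); have := LYn n x (leqnn n).
  have := LYn n.+1 x (leqnSn n); have := Y_le1 n (L x - Y n x).
  have := ler_wpM2l (ltW e0) (L_le1 x); lra.
apply/eqP; rewrite -subr_eq0; apply/eqP.
have [c c0 Tc] := bop_bound T.
apply: (@rnorm_eps_eq0 _ _ _ (c * rnorm x + rnorm (T x))) => e e0.
have [n /(_ n)LYn] := LY _ e0.
have -> : T (L x) - L (T x) = T (L x - Y n x) - (L (T x) - Y n (T x)).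
  by rewrite linearB (sqrt_iter_comm _ _ TB) opprB addrA subrK.
rewrite (le_trans (rnormD _ _)) // rnormN.
have := LYn (T x) (leqnn n); have := Tc (L x - Y n x).
by have := ler_wpM2l c0 (LYn x (leqnn n)); lra.
Qed.

End Iteration.
End SquareRoot.

(** * Positive operators and [sqrt_op] *)

Section PositiveOperators.
Context {R : realType}.
Implicit Types H K : hilbertType R.

Lemma Im_inner_eq0 H (x y : H) : '[x, y] = '[y, x] -> complex.Im '[x, y] = 0.
Proof.
rewrite (innerC y); case: ('[x, y]) => a b [] /= bb.
by lra.
Qed.

(** The defect [h x y = <S x, y> - <x, S y>] vanishes on the diagonal; polarising at
    [x + y] and at [x + i y] makes it both antisymmetric and symmetric. *)
Lemma positive_sym H (S : 'B(H)) :
  positive_op S -> forall x y, '[S x, y] = '[x, S y].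
Proof.
move=> S0; pose h x y := '[S x, y] - '[x, S y].
have hxx x : h x x = 0.
  have := S0 x; rewrite /h (innerC x); case: ('[S x, x]) => a b.
  rewrite lecE /= => /andP[/eqP -> _]; apply/eqP.
  by rewrite eq_complex /= oppr0 !subrr eqxx.
have hD x x' z z' : h (x + x') (z + z') = h x z + h x z' + h x' z + h x' z'.
  by rewrite /h !(linearD S) !innerDl !innerDr; ring.
have hsym x z : h x z + h z x = 0.
  by have := hxx (x + z); rewrite hD !hxx !(add0r, addr0).
move=> x y; apply/eqP; rewrite -subr_eq0 -/(h x y); apply/eqP.
have hZ : h x ('i *: y) = - 'i * h x y /\ h ('i *: y) x = 'i * h y x.
  by rewrite /h !(linearZZ S) !innerZl !innerZr conjCi; split; ring.
have := hsym x ('i *: y); rewrite hZ.1 hZ.2 mulNr addrC -mulrBr => /eqP.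
rewrite mulf_eq0 (negPf (neq0Ci _)) /= subr_eq0 => /eqP hyx.
have := hsym x y; rewrite hyx => /eqP.
by rewrite -mulr2n mulrn_eq0 /= => /eqP.
Qed.

(** The Cauchy-Schwarz argument for the form [<S x, y>]: vary [x] along
    [t (S x)]. *)
Lemma positive_eq0 H (S : 'B(H)) x :
  positive_op S -> rinner (S x) x = 0 -> S x = 0.
Proof.
move=> S0 Sx; have S_sym := positive_sym S0.
have r_sym u v : rinner (S u) v = rinner u (S v) by rewrite /rinner S_sym.
have r0 u : 0 <= rinner (S u) u by have := S0 u; rewrite lecE => /andP[].
apply: rnorm_eq0; apply/eqP; rewrite -sqrf_eq0 -rinner_sqr; apply/eqP.
apply: (@linear_form_eq0 _ _ (rinner (S (S x)) (S x))) => // t.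
have := r0 (x + t%:C%C *: S x); rewrite (linearD S) (linearZZ S).
rewrite !(rinnerDl, rinnerDr, rinnerZl, rinnerZr) Sx (r_sym (S x) x); lra.
Qed.

(** Scaling [A] so that [adj A] becomes a contraction makes [I - k A^* A], with
    [k = a^-2], a contraction to which [sqrt_fixpoint] applies. *)
Lemma sqrt_exists H K (A : 'B(H, K)) : exists S : 'B(H),
  [/\ positive_op S, forall x, S (S x) = adj A (A x) &
    forall T : 'B(H), (forall x, T (adj A (A x)) = adj A (A (T x))) ->
      forall x, T (S x) = S (T x)].
Proof.
have [a a1 Aa] : exists2 a : R, 0 < a & forall y, rnorm (adj A y) <= a * rnorm y.
  have [a a0 Aa] := bop_bound (adj A); exists (a + 1) => [|y]; first by lra.
  by rewrite (le_trans (Aa y)) // ler_wpM2r ?rnorm_ge0 ?lerDl.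
have [C CE] := bop_comp (adj A) A.
pose k : R := (a ^+ 2)^-1.
have k0 : 0 <= k by rewrite invr_ge0 sqr_ge0.
have ka : k * a ^+ 2 = 1 by rewrite mulVf // sqrf_eq0 gt_eqF.
have [c c0 Cc] := bop_bound C.
have [||B BE] := @bop_of_fun _ _ _ (fun x => x - k%:C%C *: C x) (1 + k * c).
- move=> b x y; apply: eq_inner => w.
  by rewrite (linearP C) !(innerDl, innerNl, innerZl); ring.
- move=> x; rewrite (le_trans (rnormD _ _)) // rnormN rnormZ // mulrDl mul1r.
  by rewrite lerD2l -mulrA ler_wpM2l.
have C_sym x y : '[C x, y] = '[x, C y] by rewrite !CE -adjPr adjP.
have B_sym x y : '[B x, y] = '[x, B y].
  by rewrite !BE innerBl innerBr innerZl innerZr conjcR C_sym.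
have B_le1 x : rnorm (B x) <= rnorm x.
  rewrite -(@ler_pXn2r _ 2) ?nnegrE ?rnorm_ge0 // BE rnorm_sqrD rnormN rnormZ //.
  rewrite rinnerNr rinnerZr {1}CE rinnerC /rinner -adjPr inner_sqr /= exprMn.
  have : rnorm (C x) ^+ 2 <= a ^+ 2 * rnorm (A x) ^+ 2.
    by rewrite CE -exprMn ler_pXn2r ?nnegrE ?mulr_ge0 ?rnorm_ge0 // ltW.
  move=> /(ler_wpM2l (mulr_ge0 k0 k0)).
  have -> : k * k * (a ^+ 2 * rnorm (A x) ^+ 2) =
      k * a ^+ 2 * (k * rnorm (A x) ^+ 2) by ring.
  rewrite ka mul1r.
  have := mulr_ge0 k0 (sqr_ge0 (rnorm (A x))).
  by rewrite -expr2; lra.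
have [L [L_sym L_le1 LL Lcomm]] := sqrt_fixpoint B_sym B_le1.
have [||S SE] := @bop_of_fun _ _ _ (fun x => a%:C%C *: (x - L x)) (a * 2).
- move=> b x y; apply: eq_inner => w.
  by rewrite (linearP L) !(innerDl, innerNl, innerZl); ring.
- move=> x; rewrite (rnormZ _ (ltW a1)) -(mulrA a) ler_pM2l //.
  by have := rnormD x (- L x); rewrite rnormN; have := L_le1 x; lra.
exists S; split.
- move=> x; rewrite SE innerZl innerBl inner_sqr pmulr_rge0 ?ltcR // lecE.
  have -> : '[L x, x] = (rinner (L x) x)%:C%C.
    rewrite /rinner; have := @Im_inner_eq0 _ (L x) x (L_sym x x).
    by case: ('[_, _]) => u v /= ->.
  rewrite /= subrr eqxx /= subr_ge0 (le_trans (rinner_le _ _)) //.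
  by rewrite expr2 ler_wpM2r ?rnorm_ge0.
- move=> x; rewrite -CE !SE (linearZZ L) (linearB L) LL BE.
  apply: eq_inner => w; rewrite !(innerZl, innerDl, innerNl).
  have : (a%:C * a%:C * k%:C = 1 :> R[i])%C.
    by rewrite -!rmorphM mulrC -expr2 ka.
  set p := (a%:C)%C; set q := (k%:C)%C => pq.
  rewrite -[RHS]mul1r -pq; ring.
move=> T TA x; rewrite !SE (linearZZ T) (linearB T) Lcomm // => y.
by rewrite !BE linearB linearZZ !CE TA.
Qed.

(** The value chosen by [sqrt_op] is only known to be some positive square root, so
    uniqueness is needed to give it the commutation property.  If [Q] and [S] are
    two roots and [S] is the one of [sqrt_exists], then [Q] and [S] commute, hence
    [(Q + S) y = 0] for [y = Q x - S x]; positivity forces [Q y = S y = 0], and so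
    [<y, y> = 0]. *)
Lemma sqrt_opP H K (A : 'B(H, K)) (Q := sqrt_op (adj A \o A)) :
  [/\ positive_op Q, forall x, Q (Q x) = adj A (A x) &
    forall T : 'B(H), (forall x, T (adj A (A x)) = adj A (A (T x))) ->
      forall x, T (Q x) = Q (T x)].
Proof.
have [S [S0 SS Scomm]] := sqrt_exists A.
have [Q0 QQ] : positive_op Q /\ Q \o Q =1 adj A \o A.
  apply: (@xgetPex _ bop0 [set T : 'B(H) | positive_op T /\ T \o T =1 adj A \o A]).
  by exists S; split=> // x; exact: SS.
have QE x : Q (Q x) = adj A (A x) by exact: QQ.
have QS x : Q (S x) = S (Q x) by apply: Scomm => y; rewrite -!QE.
suff SQ x : Q x = S x by split=> // T TA x; rewrite !SQ Scomm.
pose y := Q x - S x.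
have y0 : Q y + S y = 0.
  by rewrite /y (linearB Q) (linearB S) QE SS QS addrA subrK subrr.
have r0 (T : 'B(H)) u : positive_op T -> 0 <= rinner (T u) u.
  by move=> T0; have := T0 u; rewrite lecE => /andP[].
have Qy : Q y = - S y by apply/eqP; rewrite -addr_eq0 y0.
have rQ : rinner (Q y) y = - rinner (S y) y by rewrite Qy rinnerNl.
have rQ0 : rinner (Q y) y = 0.
  by have := r0 _ y Q0; have := r0 _ y S0; lra.
have rS0 : rinner (S y) y = 0 by lra.
apply/eqP; rewrite -subr_eq0 -/y; apply/eqP/inner_eq0.
rewrite {2}/y innerBr -(positive_sym Q0) -(positive_sym S0).
by rewrite (positive_eq0 Q0 rQ0) (positive_eq0 S0 rS0) subrr.
Qed.

End PositiveOperators.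

(** * Orthonormal bases *)

Section Dimension.
Context {R : realType}.
Implicit Types H K : hilbertType R.

(** A maximal orthonormal set, by Zorn's lemma, has trivial orthogonal
    complement: otherwise a normalised orthogonal vector would enlarge it. *)
Lemma orthonormal_basis_exists H : exists E : set H, orthonormal_basis E.
Proof.
pose orthonormal (E : set H) := forall x y, E x -> E y -> '[x, y] = (x == y)%:R.
have [F Fon Ftot|E [Eon Emax]] := @Zorn_bigcup _ orthonormal.
  move=> x y [X FX Xx] [Y FY Yy].
  by have [XY|YX] := Ftot _ _ FX FY; [apply: (Fon Y) => //; exact: XY|
    apply: (Fon X) => //; exact: YX].
exists E; split => // x xE; apply: contrapT => /eqP x0.
have nx0 : rnorm x != 0 by apply: contra_neq x0 => /rnorm_eq0.
pose u := ((rnorm x)^-1)%:C%C *: x.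
have uE e : E e -> '[u, e] = 0 by move=> Ee; rewrite innerZl xE ?mulr0.
have u1 : '[u, u] = 1.
  rewrite innerZl innerZr conjcR inner_sqr -!rmorphM.
  by rewrite (_ : _ * _ = 1) //; field.
have nEu : ~ E u by move=> /uE; rewrite u1 => /eqP; rewrite oner_eq0.
apply: (Emax (E `|` [set u])).
  by split=> [y Ey|/(_ u)Eu]; [left|apply/nEu/Eu; right].
have ne e : E e -> (u == e) = false by move=> Ee; apply/eqP => ue; rewrite ue in nEu.
move=> y z [Ey|->] [Ez|->].
- exact: Eon.
- by rewrite inner_swap0 ?uE // eq_sym ne.
- by rewrite uE // ne.
- by rewrite u1 eqxx.
Qed.

Lemma unitary_same_dim H K (U : 'B(H, K)) (U' : K -> H) :
  (forall x y, '[U x, U y] = '[x, y]) -> cancel U' U -> same_dim H K.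
Proof.
move=> Ui UK; have [E [Eon Etot]] := orthonormal_basis_exists H.
have U_inj : injective U.
  move=> x y xy; apply/eqP; rewrite -subr_eq0; apply/eqP/inner_eq0.
  by rewrite -Ui linearB xy subrr inner0l.
exists E, (U @` E); split => //.
  split=> [_ _ [x Ex <-] [y Ey <-]|y yE].
    by rewrite Ui Eon // (inj_eq U_inj).
  rewrite -(UK y); suff -> : U' y = 0 by rewrite linear0.
  by apply: Etot => e Ee; rewrite -Ui UK; apply: yE; exists e.
by rewrite card_eq_sym; apply: inj_card_eq => x y _ _; exact: U_inj.
Qed.

End Dimension.

(** * Polar decomposition and a unitary that makes it self-adjoint *)

Section Polar.
Context {R : realType} {H K : hilbertType R} (A : 'B(H, K)).
Let Q := sqrt_op (adj A \o A).

Lemma sqrt_op_sym x y : '[Q x, y] = '[x, Q y].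
Proof. by have [/positive_sym] := sqrt_opP A. Qed.

Lemma inner_sqrt_op x y : '[Q x, Q y] = '[A x, A y].
Proof. by have [_ QQ _] := sqrt_opP A; rewrite sqrt_op_sym QQ -adjP. Qed.

Lemma sqrt_op_eq0 x : Q x = 0 <-> A x = 0.
Proof.
by split=> e; apply: inner_eq0; [rewrite -inner_sqrt_op|rewrite inner_sqrt_op];
  rewrite e inner0l.
Qed.

Lemma ker_adj_range w : (forall x, '[adj A x, w] = 0) <-> A w = 0.
Proof.
split=> [Aw|Aw x]; last by rewrite -adjPr Aw inner0r.
by apply: inner_eq0; rewrite adjPr Aw.
Qed.

(** The closure of the range of [A^*] is the orthogonal complement of the null space
    of [A]; the theorem speaks of the same subspace in both ways. *)
Lemma closure_adj_rangeE z :
  closure (range (adj A)) z <-> (forall w, A w = 0 -> '[z, w] = 0).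
Proof.
split=> [Az w /ker_adj_range Aw|Az]; first exact: closure_range_orthogonal Az Aw.
by apply: closure_rangeE => w /ker_adj_range; exact: Az.
Qed.

Lemma polar_decomposition : exists V : 'B(H, K),
  [/\ forall x, V (Q x) = A x, forall x, adj V (A x) = Q x,
      forall w, A w = 0 -> V w = 0 & forall w, closure (range A) (V w)].
Proof.
have [V [VQ VA V0 Vcl]] := partial_isometry inner_sqrt_op.
exists V; split=> // w /sqrt_op_eq0 Qw; apply: V0 => x.
by rewrite sqrt_op_sym Qw inner0r.
Qed.

Context (V : 'B(H, K)).
Context (VQ : forall x, V (Q x) = A x).
Context (VA : forall x, adj V (A x) = Q x).
Context (Vcl : forall w, closure (range A) (V w)).
Context (V0 : forall w, A w = 0 -> V w = 0).

Lemma polar_adj_range u : closure (range (adj A)) (adj V u).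
Proof. by apply/closure_adj_rangeE => w Aw; rewrite -adjPr V0 // inner0r. Qed.

Lemma polar_initial z : closure (range (adj A)) z -> adj V (V z) = z.
Proof.
move=> /closure_adj_rangeE Az.
have Qz : closure (range Q) z.
  apply: closure_rangeE => w Qw; apply: Az; apply/sqrt_op_eq0.
  by apply: inner_eq0; rewrite -sqrt_op_sym Qw.
have [C CE] := bop_comp (adj V) V; have [I IE] := bop_id H.
rewrite -CE -[RHS]IE; apply: (eq_bop_closure _ Qz) => x.
by rewrite CE IE VQ VA.
Qed.

Lemma polar_final y : closure (range A) y -> V (adj V y) = y.
Proof.
move=> Ay; have [C CE] := bop_comp V (adj V); have [I IE] := bop_id K.
rewrite -CE -[RHS]IE; apply: (eq_bop_closure _ Ay) => x.
by rewrite CE IE VA VQ.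
Qed.

Context (U : 'B(K, H)) (U' : 'B(H, K)).
Context (U'U : cancel U U').
Context (U_adj : forall x y, '[U x, y] = '[x, U' y]).
Context (UA_sym : forall x y, '[U (A x), y] = '[x, U (A y)]).

(** [<U A z, w> = <z, U A w> = 0] if [A w = 0], and [V x] is a limit of vectors
    [A z]. *)
Lemma unitary_polar_range x : closure (range (adj A)) (U (V x)).
Proof.
apply/closure_adj_rangeE => w Aw; rewrite U_adj.
apply: (closure_range_orthogonal (@Vcl x)) => z.
by rewrite -U_adj UA_sym Aw linear0 inner0r.
Qed.

(** [U A] is self-adjoint and [U] is isometric, so [U A] squares to [A^* A]; it
    commutes with its own square, hence with the square root of it. *)
Lemma sqrt_op_comm_sym x : U (A (Q x)) = Q (U (A x)).
Proof.
have [S SE] := bop_comp U A; have [_ _ Qcomm] := sqrt_opP A.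
rewrite -!SE; apply: Qcomm => y.
have SS z : S (S z) = adj A (A z).
  apply: eq_innerr => t; rewrite !SE -UA_sym -adjP U_adj.
  by rewrite U'U.
by rewrite -!SS.
Qed.

(** On the range of [Q] this is [sqrt_op_comm_sym], as [V Q = A]; on the orthogonal
    complement of that range, the null space of [A], both sides vanish. *)
Lemma polar_unitary_comm x : U (V (Q x)) = Q (U (V x)).
Proof.
have [D DE] := bop_comp U V.
have [DQ DQE] := bop_comp D Q; have [QD QDE] := bop_comp Q D.
rewrite -!DE -DQE -QDE; apply: (@eq_bop_range _ _ _ _ Q) => [y|w Qw].
  by rewrite DQE QDE !DE !VQ sqrt_op_comm_sym.
have Qw0 : Q w = 0 by apply: inner_eq0; rewrite -sqrt_op_sym Qw.
have Aw0 : A w = 0 by apply/sqrt_op_eq0.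
by rewrite DQE QDE !DE Qw0 !linear0 V0 // !linear0.
Qed.

(** The operators [U V] and its adjoint agree after composition with [Q], by
    self-adjointness of [U A], and [Q] is injective on the closure of the range of
    [A^*], where both take their values. *)
Lemma polar_unitary_sym x y : '[U (V x), y] = '[x, U (V y)].
Proof.
have [D DE] := bop_comp U V.
rewrite -!DE adjP; congr '[_, _]; apply/eqP; rewrite -subr_eq0; apply/eqP.
have d_range z : closure (range (adj A)) (adj D z).
  by apply/closure_adj_rangeE => w Aw; rewrite -adjPr DE V0 // linear0 inner0r.
have D_range z : closure (range (adj A)) (D z).
  by rewrite DE; exact: unitary_polar_range.
apply: (@closure_range_eq0 _ _ _ (adj A)).
  by rewrite addrC -scaleN1r; apply: closure_range_linear.
apply/ker_adj_range/sqrt_op_eq0; rewrite linearB.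
apply/eqP; rewrite subr_eq0; apply/eqP; apply: eq_innerr => z.
rewrite -[in LHS]sqrt_op_sym -[LHS]adjP !DE -polar_unitary_comm !VQ.
by rewrite UA_sym.
Qed.

(** [U V] is self-adjoint and isometric on the initial space of [V]. *)
Lemma polar_unitary_invol z :
  closure (range (adj A)) z -> U (V (U (V z))) = z.
Proof.
move=> Az; apply: eq_inner => y.
by rewrite polar_unitary_sym U_adj U'U adjPr polar_initial.
Qed.

Lemma polar_unitary_comm_sqr x : U (V (adj A (A x))) = adj A (A (U (V x))).
Proof. by have [_ QQ _] := sqrt_opP A; rewrite -!QQ !polar_unitary_comm. Qed.

End Polar.

(** * The symmetry exchanging the range of an idempotent and its complement *)

Section Intertwining.
Context {R : realType} {H : hilbertType R} (P J : 'B(H)).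
Context (hP : idempotent_fun P).
Context (symJ : symmetry J).
Context (JPJ : forall x, J (P (J x)) = x - adj P x).

Lemma symmetry_sym x y : '[J x, y] = '[x, J y].
Proof. by rewrite adjP -symJ.1. Qed.

Lemma orthoc_rangeP y : orthoc_set (range P) y <-> adj P y = 0.
Proof.
split=> [yP|Py _ [x _ <-]]; last by rewrite adjPr Py inner0l.
by apply: eq_inner => x; rewrite -adjPr yP ?inner0l //; exists x.
Qed.

Lemma symmetry_range x : range P x -> orthoc_set (range P) (J x).
Proof.
move=> [z _ <-]; apply/orthoc_rangeP.
have := JPJ (J (P z)); rewrite symJ.2 (hP z : P (P z) = P z) => /eqP.
by rewrite eq_sym subr_eq -subr_eq0 opprD addNKr oppr_eq0 => /eqP.
Qed.

Lemma symmetry_orthoc y : orthoc_set (range P) y -> range P (J y).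
Proof.
move=> /orthoc_rangeP Py; exists (J y) => //.
by apply: (can_inj symJ.2); rewrite JPJ Py subr0 symJ.2.
Qed.

(** For [y] and [z] in the complement, [P^* J y = J y - J P y] by the hypothesis on
    [J], and [J y] is orthogonal to [z].  Multiplying by [i] turns this skew relation
    into the self-adjointness of [i J P] on the complement. *)
Lemma symmetry_block_skew y z :
  orthoc_set (range P) y -> orthoc_set (range P) z ->
  '[J (P y), z] = - '[y, J (P z)].
Proof.
move=> Py Pz; have [w _ Jy] := symmetry_orthoc Py.
have PJy : adj P (J y) = J y - J (P y).
  by rewrite -[in J (P y)](symJ.2 y) JPJ opprB addrC subrK.
rewrite -symmetry_sym adjPr PJy innerBl.
have -> : '[J y, z] = 0 by apply: inner_swap0; apply: Pz; exists w.
by rewrite sub0r opprK.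
Qed.

End Intertwining.

Theorem theorem3p5 (R : realType) (H : hilbertType R) (sepH : separable_space H)
    (P : 'B(H)) (hP : idempotent_fun P)
    (P1 : 'B(orthoc (range P), idem_range hP))
    (blockP : block_form (M := idem_range hP)
       (fun x => x) P1 (fun=> 0) (fun=> 0) P)
    (J : 'B(H)) (symJ : symmetry J)
    (JPJ : forall x, J (P (J x)) = x - adj P x) :
  same_dim (idem_range hP) (orthoc (range P)) /\
  exists V1 : 'B(closed_range (adj P1), closed_range P1),
    [/\ unitary V1,
        comp_sub (fun z => val (V1 z)) (sqrt_op (adj P1 \o P1)) P1,
        forall V' : 'B(closed_range (adj P1), closed_range P1),
          unitary V' ->
          comp_sub (fun z => val (V' z)) (sqrt_op (adj P1 \o P1)) P1 ->
          V' =1 V1 &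
    exists J1 : 'B(orthoc (sset (kernel P1))),
    exists U2 : 'B(orthoc (range P1), kernel P1),
    exists U : 'B(idem_range hP, orthoc (range P)),
      [/\ symmetry J1,
          exists2 D : 'B(orthoc (range P)),
            direct_sum_op J1 (fun _ : kernel P1 => 0 : kernel P1) D &
            D \o (adj P1 \o P1) =1 (adj P1 \o P1) \o D,
          unitary U2,
          exists2 J1V1 : 'B(closed_range P1, orthoc (sset (kernel P1))),
            comp_sub J1 (fun x => val (adj V1 x)) J1V1 &
            direct_sum_op J1V1 U2 U &
          block_form (M := idem_range hP)
            (fun=> 0) (fun y => 'i *: adj U y)
            (fun x => - ('i *: U x)) (fun=> 0) J]].
Proof.
have ii : 'i * 'i = -1 :> R[i] by rewrite -expr2 sqrCi.
have [iJ iJE] := bop_scale 'i J; have [niJ niJE] := bop_scale (- 'i) J.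
(* U is i J restricted to R(P), and U', its inverse and adjoint, is - i J restricted
   to the complement. *)
have [|U UE] := @restriction _ _ _ (idem_range hP) (orthoc (range P)) iJ.
  move=> x Px; rewrite iJE -[_ *: _]addr0; apply: sset_linear (sset0 _).
  exact: symmetry_range.
have [|U' U'E] := @restriction _ _ _ (orthoc (range P)) (idem_range hP) niJ.
  move=> x Px; rewrite niJE -[_ *: _]addr0; apply: sset_linear (sset0 _).
  exact: symmetry_orthoc.
have UU' : cancel U' U.
  move=> x; apply: val_inj; rewrite UE U'E iJE niJE linearZZ scalerA symJ.2.
  by rewrite mulrN ii opprK scale1r.
have U'U : cancel U U'.
  move=> x; apply: val_inj; rewrite U'E UE iJE niJE linearZZ scalerA symJ.2.
  by rewrite mulNr ii opprK scale1r.
have U_adj x y : '[U x, y] = '[x, U' y].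
  rewrite !csub_inner UE U'E iJE niJE innerZl innerZr (symmetry_sym symJ).
  by rewrite rmorphN /= conjCi opprK.
have P1E y : val (P1 y) = P (val y).
  by have := blockP 0 y; rewrite !linear0 !add0r addr0 => ->.
have UA_sym x y : '[U (P1 x), y] = '[x, U (P1 y)].
  rewrite !csub_inner !UE !P1E !iJE innerZl innerZr conjCi.
  by rewrite (symmetry_block_skew symJ JPJ (csub_mem x) (csub_mem y)) mulrN mulNr.
split; first by apply: (@unitary_same_dim _ _ _ U U') => // x y; rewrite U_adj U'U.
(* The operators of the statement are restrictions of two operators on the whole
   spaces, the partial isometry V and the product D = U V. *)
have [V [VQ VA V0 Vcl]] := polar_decomposition P1.
have Vadj := polar_adj_range V0; have Vi := polar_initial VQ VA.
have Vf := polar_final VQ VA.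
have [|V1 V1E] := @restriction _ _ _ (closed_range (adj P1)) (closed_range P1) V.
  by move=> x _; exact: Vcl.
have [|V1' V1'E] :=
  @restriction _ _ _ (closed_range P1) (closed_range (adj P1)) (adj V).
  by move=> x _; exact: Vadj.
have adjV1 : adj V1 =1 V1' by apply: adj_restriction V1E V1'E => x y; rewrite adjP.
have kerE z : sset (orthoc (sset (kernel P1))) z <-> closure (range (adj P1)) z.
  by rewrite closure_adj_rangeE.
have Qran x : closure (range (adj P1)) (sqrt_op (adj P1 \o P1) x).
  by rewrite -VA; exact: Vadj.
exists V1; split.
- split=> x; apply: val_inj.
    by rewrite adjV1 V1'E V1E Vi //; exact: (csub_mem x).
  by rewrite V1E adjV1 V1'E Vf //; exact: (csub_mem x).
- move=> x; have [z zE] := csub_ex (Qran x : sset (closed_range (adj P1)) _).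
  by exists z => //; rewrite V1E zE VQ.
(* Uniqueness: V' z and V z lie in the closure of R(P1) and have the same inner
   products with its elements P1 x, as V' is isometric and sends Q x to P1 x. *)
- move=> V' V'u V'Q z; apply: val_inj; rewrite V1E; apply/eqP.
  rewrite -subr_eq0; apply/eqP; apply: (@closure_range_eq0 _ _ _ P1).
    rewrite addrC -scaleN1r; apply: closure_range_linear; first exact: Vcl.
    exact: (csub_mem (V' z)).
  move=> x; rewrite innerBr; have [w wE xE] := V'Q x.
  rewrite [X in _ - X]adjPr VA xE -csub_inner adjP V'u.1 csub_inner wE.
  by rewrite subrr.
have [D DE] := bop_comp U V.
have D_sym := polar_unitary_sym VQ Vcl V0 U'U U_adj UA_sym.
have D_ran x : closure (range (adj P1)) (U (V x)).
  exact: (@unitary_polar_range _ _ _ _ _ Vcl _ _ U_adj UA_sym x).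
have D_invol := polar_unitary_invol VQ VA Vcl V0 U'U U_adj UA_sym.
have [|J1 J1E] :=
  @restriction _ _ _ (orthoc (sset (kernel P1))) (orthoc (sset (kernel P1))) D.
  by move=> x _; apply/kerE; rewrite DE; exact: D_ran.
have [|U2 U2E] := @restriction _ _ _ (orthoc (range P1)) (kernel P1) U.
  move=> x xP1; apply: inner_eq0.
  by rewrite -[X in '[_, X]]U'U -U_adj UA_sym U_adj U'U xP1.
have [|U2' U2'E] := @restriction _ _ _ (kernel P1) (orthoc (range P1)) U'.
  move=> x xP1 _ [y _ <-]; apply: inner_swap0.
  by rewrite -U_adj UA_sym xP1 linear0 inner0r.
have adjU2 : adj U2 =1 U2' by apply: adj_restriction U2E U2'E => x y; exact: U_adj.
exists J1, U2, U; split.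
- split=> [x|x].
    symmetry; apply: adj_unique => y z.
    by rewrite [LHS]csub_inner [RHS]csub_inner !J1E !DE D_sym.
  by apply: val_inj; rewrite !J1E !DE D_invol //; apply/kerE; exact: (csub_mem x).
- exists D => [x y|x]; last first.
    by rewrite /= !DE (polar_unitary_comm_sqr VQ V0 U'U U_adj UA_sym).
  rewrite linearD J1E linear0 addr0 [X in _ + X]DE V0 ?linear0 ?addr0 //.
  exact: (csub_mem y).
- split=> x; apply: val_inj.
    by rewrite adjU2 U2'E U2E U'U.
  by rewrite U2E adjU2 U2'E UU'.
- have [|J1V1 JVE] :=
    @restriction _ _ _ (closed_range P1) (orthoc (sset (kernel P1))) U.
    move=> x Px; apply/kerE; rewrite -(Vf x Px); exact: D_ran.
  exists J1V1 => [x|x y].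
    have [|z zE] := @csub_ex _ _ (orthoc (sset (kernel P1))) (val (adj V1 x)).
      by apply/kerE; exact: (csub_mem (adj V1 x)).
    exists z => //; apply: val_inj; rewrite JVE J1E zE adjV1 V1'E DE Vf //.
    exact: (csub_mem x).
  by rewrite linearD JVE U2E.
move=> x y; rewrite (linearD J) add0r addr0 (adj_unique U_adj) [RHS]addrC.
congr (_ + _).
  by rewrite -scaleNr linearZZ /= UE iJE scalerA mulNr ii opprK scale1r.
by rewrite linearZZ /= U'E niJE scalerA mulrN ii opprK scale1r.
Qed.
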